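(* Let $(\Omega,\mathcal F)$ be a measurable space and let $\mathcal P,\mathcal Q\subset\mathcal M_1$ be nonempty. For any $\phi\in\Phi$, $\mu\in\overline{\mathrm{co}}^*(\mathcal P)$, $\nu\in\overline{\mathrm{co}}^*(\mathcal Q)$, $$R(\phi,\mathcal P,\mathcal Q)\ge 1-\mathrm d_{\mathrm{TV}}(\mu,\nu).$$ Consequently, if $\phi^*\in\Phi$, $\mu^*\in\overline{\mathrm{co}}^*(\mathcal P)$, $\nu^*\in\overline{\mathrm{co}}^*(\mathcal Q)$ satisfy $R(\phi^*,\mathcal P,\mathcal Q)=1-\mathrm d_{\mathrm{TV}}(\mu^*,\nu^* )$, then $\phi^*$ is minimax optimal, i.e. $R(\phi^*,\mathcal P,\mathcal Q)=R(\mathcal P,\mathcal Q)$, and $(\mu^*,\nu^* )$ is a TV-closest pair, i.e. $\mathrm d_{\mathrm{TV}}(\mu^*,\nu^* )=\mathrm d_{\mathrm{TV}}(\overline{\mathrm{co}}^*(\mathcal P),\overline{\mathrm{co}}^*(\mathcal Q))$.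
   Context: $\mathcal M_1$ is the set of all countably additive probability measures on $(\Omega,\mathcal F)$. A test is an $\mathcal F$-measurable function $\phi:\Omega\to[0,1]$; $\Phi$ is the set of all tests. The risk of a test is $R(\phi,\mathcal P,\mathcal Q)=\sup_{\mu\in\mathcal P}\mathbb E_\mu[\phi]+\sup_{\nu\in\mathcal Q}\mathbb E_\nu[1-\phi]$ and the minimax risk is $R(\mathcal P,\mathcal Q)=\inf_{\phi\in\Phi}R(\phi,\mathcal P,\mathcal Q)$. $\mathcal L$ is the Banach space of bounded measurable real functions on $\Omega$ with the supremum norm. $\mathsf{ba}$ is the space of bounded finitely additive real-valued set functions on $\mathcal F$, with norm $\|\mu\|_{\mathrm{TV}}=\sup_\pi\sum_{A\in\pi}|\mu(A)|$ (supremum over finite measurable partitions $\pi$ of $\Omega$); it is the dual of $\mathcal L$ via $\mathbb E_\mu[f]=\int f\,d\mu$ (integral of simple functions extended by uniform limits). $\mathsf{ba}_1$ is the set of nonnegative elements of $\mathsf{ba}$ with $\mu(\Omega)=1$; $\mathcal M_1\subset\mathsf{ba}_1$. The weak-$*$ topology on $\mathsf{ba}$ is the weakest topology making $\mu\mapsto\mathbb E_\mu[f]$ continuous for all $f\in\mathcal L$. $\mathrm{co}(\mathcal P)$ is the convex hull and $\overline{\mathrm{co}}^*(\mathcal P)$ is the weak-$*$ closure in $\mathsf{ba}$ of $\mathrm{co}(\mathcal P)$. For $\mu,\nu\in\mathsf{ba}_1$, $\mathrm d_{\mathrm{TV}}(\mu,\nu)=\tfrac12\|\mu-\nu\|_{\mathrm{TV}}=\sup_{\phi\in\Phi}(\mathbb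 E_\mu[\phi]-\mathbb E_\nu[\phi])$; for nonempty $S,T\subset\mathsf{ba}_1$, $\mathrm d_{\mathrm{TV}}(S,T)=\inf_{\mu\in S,\nu\in T}\mathrm d_{\mathrm{TV}}(\mu,\nu)$. *)

(* Defs.v *)
From HB Require Import structures.
From mathcomp Require Import all_boot all_order all_algebra.
From mathcomp Require Import all_classical all_reals all_analysis.

Set Implicit Arguments.
Unset Strict Implicit.
Unset Printing Implicit Defensive.
Import Order.TTheory GRing.Theory Num.Theory.
Import numFieldNormedType.Exports.
Local Open Scope classical_set_scope.
Local Open Scope ring_scope.

Section ba.
Context (R : realType) (d : measure_display) (T : measurableType d).

(* Bounded finitely additive real set functions on the sigma-algebra.  They
   are represented by functions on all subsets of T; the first clause fixes
   the irrelevant values off the sigma-algebra, so that equality in ba is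
   equality on measurable sets. *)
Definition is_ba : set (set T -> R^o) :=
  [set mu | [/\ forall A, ~ measurable A -> mu A = 0,
      forall A B, measurable A -> measurable B -> A `&` B = set0 ->
        mu (A `|` B) = mu A + mu B
    & exists M : R, forall A, measurable A -> `|mu A| <= M]].

Definition ba_pred : {pred set T -> R^o} := mem is_ba.

Lemma ba_submod_closed : submod_closed ba_pred.
Proof.
split=> [|a mu nu].
  rewrite inE; split => //; first by move=> A B _ _ _; rewrite addr0.
  by exists 0 => A _; rewrite normr0.
rewrite !inE => -[mu0 muD [M muM]] [nu0 nuD [N nuN]].
have E A : (a *: mu + nu) A = a * mu A + nu A by [].
split.
- by move=> A mA; rewrite E mu0// nu0// mulr0 addr0.
- by move=> A B mA mB AB; rewrite !E muD// nuD// mulrDr addrACA.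
- exists (`|a| * M + N) => A mA.
  rewrite E (le_trans (ler_normD _ _))// lerD ?nuN//.
  by rewrite normrM ler_wpM2l// muM.
Qed.

HB.instance Definition _ :=
  GRing.isSubmodClosed.Build R (set T -> R^o) ba_pred ba_submod_closed.

Record ba : Type := Ba { ba_fun :> set T -> R^o ; _ : ba_fun \in ba_pred }.

HB.instance Definition _ := [isSub for ba_fun].
HB.instance Definition _ := [Choice of ba by <:].
HB.instance Definition _ := [SubChoice_isSubLmodule of ba by <:].

End ba.

Section integral.
Import HBSimple.
Context (R : realType) (d : measure_display) (T : measurableType d).

Definition sfun_integral (mu : ba R T) (g : {sfun T >-> R}) : R :=
  \sum_(y \in range g) y * mu (g @^-1` [set y]).

(* The trace on simple functions of the neighborhoods of f for the topology
   of uniform convergence. *)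
Definition sfun_near (f : T -> R) : set_system {sfun T >-> R} :=
  filter_from [set e : R | 0 < e]
    (fun e => [set g : {sfun T >-> R} | forall x, `|f x - g x| < e]).

Definition ba_integral (mu : ba R T) (f : T -> R) : R :=
  lim (sfun_integral mu g @[g --> sfun_near f]).

Definition bounded_measurable : set (T -> R) :=
  [set f : T -> R | measurable_fun setT f /\ bounded_fun f].

Definition weak_star : Type :=
  sup_topology (fun f : bounded_measurable =>
    Topological.class
      (initial_topology (fun mu : ba R T => ba_integral mu (set_val f)))).

HB.instance Definition _ := Topological.on weak_star.

Definition weak_star_closure (S : set (ba R T)) : set (ba R T) :=
  closure (S : set weak_star).

Definition convex_hull (S : set (ba R T)) : set (ba R T) :=
  smallest (@convex_set R (ba R T)) S.

End integral.

Section total_variation.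
Context (R : realType) (d : measure_display) (T : measurableType d).

Definition finite_measurable_partition : set (set (set T)) :=
  [set pi | [/\ finite_set pi, pi `<=` measurable & partition pi id setT]].

Definition tv_norm (mu : ba R T) : R :=
  sup [set \sum_(A \in pi) `|mu A| | pi in finite_measurable_partition].

Definition dTV (mu nu : ba R T) : R := 2^-1 * tv_norm (mu - nu).

(* inf has a junk value on the empty set: S and S' are meant to be nonempty. *)
Definition dTV_set (S S' : set (ba R T)) : R :=
  inf [set dTV mu nu | mu in S & nu in S'].

End total_variation.

Section testing.
Context (R : realType) (d : measure_display) (T : measurableType d).

Definition prob_fun (mu : probability T R) : set T -> R^o :=
  fun A => if A \in measurable then fine (mu A) else 0.

Lemma prob_fun_ba (mu : probability T R) : prob_fun mu \in @ba_pred R d T.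
Proof.
rewrite inE; split.
- by move=> A mA; rewrite /prob_fun memNset.
- move=> A B mA mB AB; rewrite /prob_fun !mem_set//; last exact: measurableU.
  by rewrite measureU// fineD// fin_num_measure.
- exists 1 => A mA; rewrite /prob_fun mem_set// ger0_norm ?fine_ge0//.
  by rewrite -lee_fin fineK ?fin_num_measure// probability_le1.
Qed.

Definition ba_of_probability (mu : probability T R) : ba R T :=
  Ba (prob_fun_ba mu).

Definition closed_convex_hull (P : set (probability T R)) : set (ba R T) :=
  weak_star_closure (convex_hull (ba_of_probability @` P)).

Definition tests : set (T -> R) :=
  [set phi : T -> R | measurable_fun setT phi /\ forall x, 0 <= phi x <= 1].

(* Suprema and infima are taken in R: for a test phi and nonempty P and Q all
   the sets involved are nonempty and bounded. *)
Definition risk (phi : T -> R) (P Q : set (probability T R)) : R :=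
  sup [set fine 'E_mu[phi] | mu in P] +
  sup [set fine 'E_nu[fun x => 1 - phi x] | nu in Q].

Definition minimax_risk (P Q : set (probability T R)) : R :=
  inf [set risk phi P Q | phi in tests].

End testing.

(* Main.v *)
(* For a test phi, the map mu |-> E_mu[phi] is affine and weak-* continuous on
   ba, so each half-space {E_mu[phi] <= c} containing P contains the weak-*
   closed convex hull of P; the same with phi = 1 shows that mu(T) = 1 on the
   hull.  Hence risk phi P Q >= E_mu[phi] + 1 - E_nu[phi] for mu, nu in the
   hulls, and |E_mu[phi] - E_nu[phi]| <= dTV mu nu since mu - nu has total
   mass 0.  A pair attaining equality is then optimal on both sides. *)

Require Import Defs.
From mathcomp Require Import all_boot all_order all_algebra.
From mathcomp Require Import all_classical all_reals all_analysis.
From mathcomp Require Import measurable_realfun lra.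
Set Implicit Arguments.
Unset Strict Implicit.
Unset Printing Implicit Defensive.
Import Order.TTheory GRing.Theory Num.Theory.
Import numFieldNormedType.Exports.
Local Open Scope classical_set_scope.
Local Open Scope ring_scope.

(** * Norm and monotonicity estimates for finite sums *)

Lemma ler_norm_fsum (R : numDomainType) (I : choiceType) (D : set I) (F : I -> R) :
  finite_set D -> `|\sum_(i \in D) F i| <= \sum_(i \in D) `|F i|.
Proof. by move=> Df; rewrite !fsbig_finite//= ler_norm_sum. Qed.

Lemma ler_fsum (R : numDomainType) (I : choiceType) (D : set I) (F G : I -> R) :
  finite_set D -> (forall i, D i -> F i <= G i) ->
  \sum_(i \in D) F i <= \sum_(i \in D) G i.
Proof.
move=> Df FG; rewrite !fsbig_finite//= big_seq [leRHS]big_seq.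
by apply: ler_sum => i; rewrite in_fset_set// inE => /FG.
Qed.

(** * Finite additivity and bounded variation of elements of [ba] *)

Section ba_theory.
Context (R : realType) (d : measure_display) (T : measurableType d).
Implicit Types mu nu : ba R T.

Lemma ba_setU mu (A B : set T) : measurable A -> measurable B ->
  A `&` B = set0 -> mu (A `|` B) = mu A + mu B.
Proof. by have := valP mu; rewrite inE => -[_ + _]; exact. Qed.

Lemma ba_bounded mu : exists M : R, forall A, measurable A -> `|mu A| <= M.
Proof. by have := valP mu; rewrite inE => -[]. Qed.

Lemma ba_set0 mu : mu set0 = 0.
Proof.
have := @ba_setU mu set0 set0 measurable0 measurable0 (setI0 _).
by rewrite setU0 => /eqP; rewrite -subr_eq subrr eq_sym => /eqP.
Qed.

Lemma ba_subE mu nu A : (mu - nu) A = mu A - nu A. Proof. by []. Qed.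

Lemma ba_fin_bigcup mu (I : choiceType) (D : set I) (F : I -> set T) :
  finite_set D -> trivIset D F -> (forall i, D i -> measurable (F i)) ->
  mu (\bigcup_(i in D) F i) = \sum_(i \in D) mu (F i).
Proof.
suff aux s : uniq s -> trivIset [set` s] F ->
    (forall i, [set` s] i -> measurable (F i)) ->
    mu (\bigcup_(i in [set` s]) F i) = \sum_(i <- s) mu (F i).
  move=> /finite_fsetP[X ->]; rewrite -fsbig_seq//=.
  exact: (aux _ (finmap.fset_uniq X)).
elim: s => [_ _ _|i s IHs /= /andP[si us] sF mF].
  by rewrite big_nil -(ba_set0 mu); congr (mu _); rewrite -subset0 => t [].
rewrite big_cons -(IHs us); last 2 first.
- by apply: sub_trivIset sF => j js /=; rewrite inE [j \in s]js orbT.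
- by move=> j /= js; apply: mF; rewrite /= inE js orbT.
rewrite -ba_setU; last 3 first.
- by apply: mF; rewrite /= inE eqxx.
- apply: fin_bigcup_measurable => [|j /= js]; first exact: finite_seq.
  apply: mF.
  by rewrite /= inE js orbT.
- rewrite -subset0 => t [Fit [j /= js Fjt]].
  have /= ij : i = j.
    by apply: sF; rewrite /= ?inE ?eqxx ?js ?orbT//; exists t.
  by move: si; rewrite ij js.
congr (mu _); apply/seteqP; split => [t [j /=]|t [Fit|[j /= js Fjt]]].
- by rewrite inE => /predU1P[-> Fit|js Fjt]; [left|right; exists j].
- by exists i => //=; rewrite inE eqxx.
- by exists j => //=; rewrite inE js orbT.
Qed.

(** A bounded charge has finite variation. Split the indices by the sign of [mu (F i)]: on each half
    the sum of absolute values is, up to sign, the value of [mu] on one measurable union, hence at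
    most [M]. So [K] is twice [M], whatever the family. *)
Lemma ba_fsum_normr_le mu : exists2 K : R, 0 <= K &
  forall (I : choiceType) (D : set I) (F : I -> set T),
  finite_set D -> trivIset D F -> (forall i, D i -> measurable (F i)) ->
  \sum_(i \in D) `|mu (F i)| <= K.
Proof.
have [M muM] := ba_bounded mu.
exists (M *+ 2) => [|I D F Dfin tF mF].
  by rewrite mulrn_wge0// (le_trans (normr_ge0 (mu set0)))// muM.
rewrite (fsbigID [set i | 0 <= mu (F i)])//=.
set D1 := D `&` _; set D2 := D `&` _.
have aux D' : D' `<=` D -> `|\sum_(i \in D') mu (F i)| <= M.
  move=> D'D; rewrite -ba_fin_bigcup//.
  - apply: muM; apply: fin_bigcup_measurable; first exact: sub_finite_set Dfin.
    by move=> i /D'D /mF.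
  - exact: sub_finite_set Dfin.
  - exact: sub_trivIset tF.
  - by move=> i /D'D /mF.
rewrite mulr2n lerD//.
  apply: le_trans (aux D1 (@subIsetl _ _ _)).
  apply: le_trans (ler_norm _); rewrite le_eqVlt; apply/orP; left; apply/eqP.
  by apply: eq_fsbigr => i; rewrite inE => -[_ /= ?]; rewrite ger0_norm.
apply: le_trans (aux D2 (@subIsetl _ _ _)).
rewrite -normrN; apply: le_trans (ler_norm _).
rewrite -mulN1r mulr_fsumr le_eqVlt; apply/orP; left; apply/eqP.
apply: eq_fsbigr => i; rewrite inE => -[_ /= /negP]; rewrite -ltNge => ?.
by rewrite ltr0_norm// mulN1r.
Qed.

End ba_theory.

(** * The integral of simple functions against a charge *)

Section sfun_integral_theory.
Import HBSimple.
Context (R : realType) (d : measure_display) (T : measurableType d).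
Implicit Types (mu nu : ba R T) (f : T -> R) (g h : {sfun T >-> R}).

(** Each level set of [g] is cut along the levels of [h]. Together with its mirror image below, this
    puts two integrals on one common family of cells, so that they can be subtracted termwise. *)
Lemma sfun_integral_pair mu g h : sfun_integral mu g =
  \sum_(p \in range g `*` range h)
    p.1 * mu (g @^-1` [set p.1] `&` h @^-1` [set p.2]).
Proof.
rewrite -(pair_fsbig _ (fun y z => y * mu (g @^-1` [set y] `&` h @^-1` [set z])))//=.
apply: eq_fsbigr => y _; rewrite -mulr_fsumr; congr (_ * _).
rewrite -ba_fin_bigcup//.
- congr (mu _); apply/seteqP; split => [t gty|t [z _ []]//].
  by exists (h t) => //; exists t.
- by apply: trivIset_preimage1_in.
- by move=> z _; apply: measurableI.
Qed.

Lemma sfun_integral_pairr mu g h : sfun_integral mu h =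
  \sum_(p \in range g `*` range h)
    p.2 * mu (g @^-1` [set p.1] `&` h @^-1` [set p.2]).
Proof.
rewrite (sfun_integral_pair _ h g).
rewrite -(pair_fsbig _ (fun z y => z * mu (h @^-1` [set z] `&` g @^-1` [set y])))//=.
rewrite -(pair_fsbig _ (fun y z => z * mu (g @^-1` [set y] `&` h @^-1` [set z])))//=.
by rewrite exchange_fsbig//=; under eq_fsbigr do under eq_fsbigr do rewrite setIC.
Qed.

(** On the common cells the difference is a sum of terms [(y - z) * mu C] with [y - z] at most [e]
    in absolute value on nonempty cells; the finite variation of [mu] bounds the rest. The constant
    depends on [mu] only. *)
Lemma sfun_integral_lipschitz mu : exists2 K : R, 0 <= K &
  forall g h (e : R), 0 <= e -> (forall x, `|g x - h x| <= e) ->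
  `|sfun_integral mu g - sfun_integral mu h| <= e * K.
Proof.
have [K K0 muK] := ba_fsum_normr_le mu; exists K => // g h e e0 ghe.
rewrite (sfun_integral_pair mu g h) (sfun_integral_pairr mu g h).
have Dfin : finite_set (range g `*` range h) by exact: finite_setX.
set D := range g `*` range h in Dfin *.
pose C (p : R * R) := g @^-1` [set p.1] `&` h @^-1` [set p.2].
rewrite -mulN1r mulr_fsumr -fsbig_split//=.
apply: le_trans (ler_norm_fsum _ _) _ => //.
apply: (@le_trans _ _ (\sum_(p \in D) e * `|mu (C p)|)).
  apply: ler_fsum => // p _; rewrite mulN1r -mulrBl normrM.
  rewrite -/(C p).
  (* An empty cell gives no control on the difference of the two values, but [mu] vanishes there. *)
  have [->|/set0P[t [/= gp hp]]] := eqVneq (C p) set0.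
    by rewrite ba_set0 normr0 !mulr0.
  by rewrite ler_wpM2r// -gp -hp.
rewrite -mulr_fsumr.
rewrite ler_wpM2l// muK//.
- move=> p q _ _ [t [[/= gp hp] [/= gq hq]]].
  by rewrite (surjective_pairing p) (surjective_pairing q) -gp -hp -gq -hq.
- by move=> p _; apply: measurableI.
Qed.

End sfun_integral_theory.

(** * Expectations under countably additive probabilities *)

Section probability_expectation.
Import HBSimple.
Context (R : realType) (d : measure_display) (T : measurableType d).
Variable P : probability T R.
Implicit Types (f : T -> R) (g : {sfun T >-> R}).

Lemma bounded_measurable_integrable f : bounded_measurable f ->
  P.-integrable setT (EFin \o f).
Proof.
move=> [mf bf]; apply: measurable_bounded_integrable => //.
by rewrite -ge0_fin_numE// fin_num_measure.
Qed.

Lemma fine_expectation f : fine 'E_P[f] = \int[P]_x f x.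
Proof. by rewrite unlock. Qed.

Lemma sfun_integral_probability g :
  sfun_integral (ba_of_probability P) g = \int[P]_x g x.
Proof.
have intI y : P.-integrable setT (fun x => (y * \1_(g @^-1` [set y]) x)%:E).
  under eq_fun do rewrite EFinM; apply: integrableZl => //.
  exact: integrable_indic.
rewrite /Rintegral.
under eq_integral do rewrite fimfunE fsbig_finite//= -sumEFin.
rewrite integral_sum//.
under eq_bigr => y _.
  under eq_integral do rewrite EFinM.
  rewrite integralZl//=; last exact: integrable_indic.
  rewrite integral_indic// setIT -[X in (_ * X)%E]fineK ?fin_num_measure// -EFinM; over.
rewrite sumEFin /= /sfun_integral fsbig_finite//=; apply: eq_bigr => y _.
by rewrite /prob_fun mem_set.
Qed.

Lemma Rintegral_dist f g (e : R) : bounded_measurable f ->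
  (forall x, `|f x - g x| <= e) ->
  `|\int[P]_x f x - \int[P]_x g x| <= e.
Proof.
move=> bmf fge.
have intf := bounded_measurable_integrable bmf.
have intg : P.-integrable setT (EFin \o g).
  apply: bounded_measurable_integrable; split; first exact: measurable_funPT.
  exact: simple_bounded.
have intfg : P.-integrable setT (EFin \o (fun x => f x - g x)).
  exact: (integrableB measurableT intf intg).
rewrite -RintegralB//; apply: le_trans (le_normr_Rintegral _ intfg) _ => //.
have -> : e = \int[P]_x (cst e x).
  by rewrite Rintegral_cst//= probability_setT mulr1.
apply: le_Rintegral => //; first exact: (integrable_norm intfg).
apply: bounded_measurable_integrable; split => //.
exact: (simple_bounded (cst_sfun e)).
Qed.

End probability_expectation.

(** * Uniform approximation and the integral of bounded measurable functions *)

Section sfun_near_theory.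
Import HBSimple.
Context (R : realType) (d : measure_display) (T : measurableType d).
Implicit Types (mu nu : ba R T) (f : T -> R) (g h : {sfun T >-> R}).

Lemma sfun_near_filter f : Filter (sfun_near f).
Proof.
apply: filter_from_filter; first by exists 1 => /=.
move=> e1 e2 /= e10 e20; exists (Num.min e1 e2) => /=.
  by rewrite lt_min e10.
by move=> g /= fg; split => x; have := fg x; rewrite lt_min => /andP[].
Qed.

(** Rounding [f] down to the grid of step [e] starting at [-M] moves it by less than [e] and leaves
    finitely many values. *)
Lemma uniform_sfun_approximation f (e : R) : bounded_measurable f -> 0 < e ->
  exists g, forall x, `|f x - g x| < e.
Proof.
move=> [mf [M0 [_ /(_ (M0 + 1))]]]; rewrite ltrDl => /(_ ltr01).
set M := M0 + 1 => bM e0.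
have fM x : `|f x| <= M by exact: bM.
pose r (t : R) := (Num.truncn ((t + M) / e))%:R * e - M.
have mr : measurable_fun setT r.
  apply: nondecreasing_measurable => // s t st.
  rewrite /r lerD2r ler_pM2r// ler_nat le_truncn//.
  by rewrite ler_pM2r ?invr_gt0// lerD2r.
pose h := r \o f.
have mh : measurable_fun setT h by exact: measurableT_comp.
(* Since [f] is at most [M], no grid index exceeds the truncation of [(M + M) / e]. *)
have fh : finite_set (range h).
  apply: (@sub_finite_set _ _
    ((fun n => n%:R * e - M) @` `I_(Num.truncn ((M + M) / e)).+1)).
    move=> _ [x _ <-]; exists (Num.truncn ((f x + M) / e)) => //=.
    rewrite ltnS le_truncn// ler_pM2r ?invr_gt0// lerD2r.
    exact: le_trans (ler_norm _) (fM x).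
  exact/finite_image/finite_II.
have hs : h \in sfun by rewrite inE; apply/andP; split; rewrite inE.
exists (sfun_Sub hs) => x; rewrite sfun_valP /h /r /=.
(* [Num.truncn] is the floor only on nonnegative arguments; the shift by [M] ensures this. *)
have fM0 : 0 <= (f x + M) / e.
  rewrite divr_ge0 ?(ltW e0)// -lerBlDr sub0r.
  by have := fM x; rewrite ler_norml => /andP[].
have /andP[h1 h2] := truncn_itv fM0.
move: h1 h2; rewrite ler_pdivlMr// ltr_pdivrMr// -natr1 => h1 h2.
by rewrite ltr_norml; apply/andP; split; lra.
Qed.

Lemma sfun_near_proper f : bounded_measurable f -> ProperFilter (sfun_near f).
Proof.
move=> bmf; apply: filter_from_proper; first exact: sfun_near_filter.
by move=> e /= e0; exact: uniform_sfun_approximation.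
Qed.

(** The limit defining [ba_integral] is genuine, not a default value: by the Lipschitz bound the
    image filter is Cauchy, and [R] is complete. *)
Lemma ba_integral_cvg mu f : bounded_measurable f ->
  sfun_integral mu g @[g --> sfun_near f] --> ba_integral mu f.
Proof.
move=> bmf; have PF := sfun_near_proper bmf.
have [K K0 muK] := sfun_integral_lipschitz mu.
suff : cvg (sfun_integral mu g @[g --> sfun_near f]) by [].
apply/cauchy_cvgP/cauchy_exP => e e0.
(* Two functions within [a] of [f] are within [a + a] of each other, and [(a + a) * K < e]; the
   denominator [K + 1] covers the case [K = 0]. *)
pose a := e / (K + 1) / 2.
have K1 : 0 < K + 1 by rewrite ltr_wpDl.
have a0 : 0 < a by rewrite !divr_gt0.
have [g0 fg0] := uniform_sfun_approximation bmf a0.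
exists (sfun_integral mu g0), a => //= g fg.
rewrite -ball_normE /=.
have : `|sfun_integral mu g0 - sfun_integral mu g| <= (a + a) * K.
  apply: muK => [|x]; first by rewrite addr_ge0// ltW.
  apply: (le_trans (ler_distD (f x) _ _)).
  by rewrite lerD// ltW// distrC.
move=> /le_lt_trans; apply.
rewrite /a -splitr mulrAC ltr_pdivrMr// ltr_pM2l// ltrDl//.
Qed.

Lemma sfun_near_le f (e : R) : 0 < e ->
  \forall g \near sfun_near f, forall x, `|f x - (g : {sfun T >-> R}) x| <= e.
Proof. by move=> e0; exists e => // g fg x; exact/ltW/fg. Qed.

Lemma ba_integralD mu nu f : bounded_measurable f ->
  ba_integral (mu + nu) f = ba_integral mu f + ba_integral nu f.
Proof.
move=> bmf; have PF := sfun_near_proper bmf; apply: cvg_lim => //.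
have -> : sfun_integral (mu + nu) = sfun_integral mu \+ sfun_integral nu.
  apply/funext => g; rewrite /= /sfun_integral -fsbig_split//=.
  by apply: eq_fsbigr => y _; exact: mulrDr.
by apply: cvgD; exact: ba_integral_cvg.
Qed.

Lemma ba_integralZ (a : R) mu f : bounded_measurable f ->
  ba_integral (a *: mu) f = a * ba_integral mu f.
Proof.
move=> bmf; have PF := sfun_near_proper bmf; apply: cvg_lim => //.
have -> : sfun_integral (a *: mu) = (fun g => a * sfun_integral mu g).
  apply/funext => g; rewrite /sfun_integral mulr_fsumr.
  by apply: eq_fsbigr => y _; exact: mulrCA.
by apply: cvgM; [exact: cvg_cst|exact: ba_integral_cvg].
Qed.

(** The two integrals agree on simple functions, and the Lebesgue integral moves by at most the
    uniform distance, so it is the limit of the simple integrals. *)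
Lemma ba_integral_probability (P : probability T R) f : bounded_measurable f ->
  ba_integral (ba_of_probability P) f = fine 'E_P[f].
Proof.
move=> bmf; have PF := sfun_near_proper bmf; apply: cvg_lim => //.
apply/cvgrPdist_le => e e0.
near=> g; rewrite sfun_integral_probability fine_expectation.
by apply: Rintegral_dist => //; near: g; exact: sfun_near_le.
Unshelve. all: by end_near.
Qed.

End sfun_near_theory.

(** * Total variation as a bound on integrals of tests *)

Section total_variation_duality.
Import HBSimple.
Context (R : realType) (d : measure_display) (T : measurableType d).
Implicit Types (mu nu : ba R T) (f phi : T -> R) (g : {sfun T >-> R}).

Lemma ba_integral_sfun mu g : ba_integral mu g = sfun_integral mu g.
Proof.
have bmg : bounded_measurable (g : T -> R).
  by split; [exact: measurable_funPT|exact: simple_bounded].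
have PF := sfun_near_proper bmg; apply: cvg_lim => //.
have [K K0 muK] := sfun_integral_lipschitz mu.
have K1 : 0 < K + 1 by rewrite ltr_wpDl.
apply/cvgrPdist_le => e e0; have eK0 : 0 < e / (K + 1) by rewrite divr_gt0.
near=> h; have : `|sfun_integral mu g - sfun_integral mu h| <= e / (K + 1) * K.
  by apply: muK; [exact: ltW|near: h; exact: sfun_near_le].
move=> /le_trans; apply.
by rewrite mulrAC ler_pdivrMr// ler_pM2l// lerDl.
Unshelve. all: by end_near.
Qed.

Lemma sfun_level_bigcup g : \bigcup_(y in range g) g @^-1` [set y] = setT.
Proof. by apply/seteqP; split => // t _; exists (g t) => //; exists t. Qed.

Lemma ba_sfun_levels mu g : \sum_(y \in range g) mu (g @^-1` [set y]) = mu setT.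
Proof.
by rewrite -ba_fin_bigcup ?sfun_level_bigcup//; exact: trivIset_preimage1.
Qed.

(** This turns total mass into an integral, to which weak-* continuity applies. *)
Lemma ba_integral_cst mu : ba_integral mu (cst 1) = mu setT.
Proof.
rewrite (ba_integral_sfun mu (cst_sfun 1)) -(ba_sfun_levels mu (cst_sfun 1)).
by apply: eq_fsbigr => y /[!inE] -[t _ <-]; rewrite mul1r.
Qed.

Lemma tv_norm_upper_bound mu (pi : set (set T)) : finite_measurable_partition pi ->
  \sum_(A \in pi) `|mu A| <= tv_norm mu.
Proof.
move=> pip; apply: ub_le_sup; last by exists pi.
have [K _ muK] := ba_fsum_normr_le mu.
by exists K => _ [pi' [pi'f mpi' [_ tpi' _]] <-]; apply: muK.
Qed.

(** The level sets over the range of [g] form a finite measurable partition, one of those in the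
    supremum. *)
Lemma sum_sfun_levels_le_tv_norm mu g :
  \sum_(y \in range g) `|mu (g @^-1` [set y])| <= tv_norm mu.
Proof.
(* Values in the range have nonempty level sets, so a level set determines its value and the sum can
   be reindexed by sets. *)
have ginj : set_inj (range g) (fun y => g @^-1` [set y]).
  move=> y z /[!inE] -[t _ <-] _ /= E.
  have : (g @^-1` [set g t]) t by [].
  by rewrite E.
rewrite -(fsbig_image _ _ (fun A => `|mu A|) ginj).
apply: tv_norm_upper_bound; split.
- exact: finite_image.
- by move=> _ [y _ <-].
- split.
  + by rewrite /cover bigcup_image sfun_level_bigcup.
  + move=> _ _ [y _ <-] [z _ <-] [t [/= <- <-]] //.
  + by move=> _ [_ [t _ <-] <-]; exists t.
Qed.

Lemma tests_bounded_measurable phi : tests phi -> bounded_measurable phi.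
Proof.
move=> [mphi phi01]; split => //; exists 1; split => // M M1 x _ /=.
by have /andP[? ?] := phi01 x; rewrite ger0_norm// (le_trans _ (ltW M1)).
Qed.

Lemma tests_cst1 : @tests R d T (cst 1).
Proof. by split => // x /=; rewrite ler01 lexx. Qed.

(* As mu(T) = 0, the test may be recentred at 1/2 before being bounded, which
   gains the factor 1/2 of the total variation distance. *)
Lemma ba_integral_test_le mu phi : mu setT = 0 -> tests phi ->
  `|ba_integral mu phi| <= 2^-1 * tv_norm mu.
Proof.
move=> mu0 tphi; have bmphi := tests_bounded_measurable tphi.
have PF := sfun_near_proper bmphi.
have N0 : 0 <= tv_norm mu.
  apply: le_trans (sum_sfun_levels_le_tv_norm mu (cst_sfun 0)).
  by apply: fsumr_ge0.
set N := tv_norm mu in N0 *.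
have N1 : 0 < N + 1 by rewrite ltr_wpDl.
have bound g (e : R) : 0 <= e -> (forall x, `|phi x - g x| <= e) ->
    `|sfun_integral mu g| <= (2^-1 + e) * N.
  move=> e0 phig.
  have -> : sfun_integral mu g =
      \sum_(y \in range g) (y - 2^-1) * mu (g @^-1` [set y]).
    rewrite -[RHS]addr0 -[X in _ = _ + X](mulr0 2^-1).
    rewrite -[X in _ = _ + _ * X]mu0 -(ba_sfun_levels mu g).
    rewrite mulr_fsumr -fsbig_split//=.
    by apply: eq_fsbigr => y _; rewrite -mulrDl subrK.
  apply: le_trans (ler_norm_fsum _ _) _ => //.
  apply: (@le_trans _ _
      (\sum_(y \in range g) (2^-1 + e) * `|mu (g @^-1` [set y])|)).
    (* Every level is a value [g t], within [e] of [phi t] in [0, 1], hence within [2^-1 + e] of the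
       midpoint. *)
    apply: ler_fsum => // _ [t _ <-]; rewrite normrM ler_wpM2r//.
    have := phig t; have /andP[p0 p1] := tphi.2 t.
    by rewrite !ler_norml => /andP[? ?]; apply/andP; split; lra.
  rewrite -mulr_fsumr ler_wpM2l ?addr_ge0//.
  exact: sum_sfun_levels_le_tv_norm.
(* The error [e] is split in two: one half for replacing [phi] by [g], the other for the excess
   [a * N]. *)
apply/ler_addgt0Pr => e e0; pose a := e / 2 / (N + 1).
have a0 : 0 < a by rewrite !divr_gt0.
have aN : a * N <= e / 2.
  by rewrite /a mulrAC ler_pdivrMr// ler_pM2l ?divr_gt0// lerDl.
near (sfun_near phi) => g.
have H1 : `|ba_integral mu phi - sfun_integral mu g| <= e / 2.
  near: g; have /cvgrPdist_le := @ba_integral_cvg _ _ _ mu _ bmphi.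
  by apply; rewrite divr_gt0.
have H2 : `|sfun_integral mu g| <= (2^-1 + a) * N.
  by apply: bound; [exact: ltW|near: g; exact: sfun_near_le].
have := ler_normD (ba_integral mu phi - sfun_integral mu g) (sfun_integral mu g).
rewrite subrK; lra.
Unshelve. all: by end_near.
Qed.

Lemma ba_integral_test_dTV mu nu phi : mu setT = nu setT -> tests phi ->
  `|ba_integral mu phi - ba_integral nu phi| <= dTV mu nu.
Proof.
move=> munu tphi; have bmphi := tests_bounded_measurable tphi.
rewrite -mulN1r -ba_integralZ// -ba_integralD// scaleN1r.
by apply: ba_integral_test_le => //; rewrite ba_subE munu subrr.
Qed.

End total_variation_duality.

(** * Linear inequalities on the weak-* closed convex hull *)

Section closed_convex_hull_theory.
Context (R : realType) (d : measure_display) (T : measurableType d).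
Implicit Types (mu nu : ba R T) (f phi : T -> R).

Lemma ba_integral_weak_star_continuous f : bounded_measurable f ->
  continuous (fun mu : weak_star R T => ba_integral mu f : R).
Proof.
move=> bmf mu.
(* [f] indexes one of the initial topologies whose supremum is the weak-* topology; convergence in
   the supremum gives convergence in that one. *)
pose i : @bounded_measurable R d T := SigSub (mem_set bmf).
have /cvg_sup/(_ i) mui : (mu : weak_star R T) --> mu by exact: cvg_id.
apply: cvg_trans (cvg_app _ mui) _.
exact: (@initial_continuous _ R^o (fun nu => ba_integral nu (set_val i)) mu).
Qed.

(** The half-space is convex and weak-* closed, so it contains the hull once it contains [P]. The
    factor [s] is a sign: 1 yields upper bounds and -1 lower bounds. *)
Lemma closed_convex_hull_integral_le (P : set (probability T R)) f (s c : R) mu :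
  bounded_measurable f -> (forall p, P p -> s * fine 'E_p[f] <= c) ->
  closed_convex_hull P mu -> s * ba_integral mu f <= c.
Proof.
move=> bmf Pc; pose H : set (ba R T) := [set nu | s * ba_integral nu f <= c].
suff : closed_convex_hull P `<=` H by exact.
have clH : closed (H : set (weak_star R T)).
  have scont : continuous (fun nu : weak_star R T => s * ba_integral nu f).
    move=> nu.
    exact: (cvgM (cvg_cst s) (@ba_integral_weak_star_continuous f bmf nu)).
  rewrite -[H]/((fun nu : weak_star R T => s * ba_integral nu f) @^-1`
    [set x | x <= c]).
  by apply: preimage_closed => [nu _|]; [exact: scont|exact: closed_le].
move=> nu; rewrite /closed_convex_hull /weak_star_closure.
(* With [H] written as its own closure, monotonicity of closure and minimality of the convex hull
   leave two goals: [H] is convex and contains [P]. *)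
rewrite [X in _ -> X nu](proj1 (closure_id _) clH).
apply: closure_subset; apply: smallest_sub => [x y l|_ [p Pp <-]].
  rewrite !inE /H /= => xH yH.
  rewrite /conv /= ba_integralD// !ba_integralZ//.
  have l0 : 0 <= l%:num by [].
  have l1 : 0 <= 1 - l%:num by rewrite subr_ge0.
  have := ler_wpM2l l0 xH; have := ler_wpM2l l1 yH; rewrite /unstable.onem; lra.
by rewrite /H /= ba_integral_probability// Pc.
Qed.

Lemma closed_convex_hull_setT (P : set (probability T R)) mu :
  closed_convex_hull P mu -> mu setT = 1.
Proof.
move=> Pmu; rewrite -ba_integral_cst.
have bm1 := tests_bounded_measurable (@tests_cst1 R d T).
have E1 (p : probability T R) : fine 'E_p[cst 1] = 1 by rewrite expectation_cst.
apply/eqP; rewrite eq_le; apply/andP; split.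
  have := @closed_convex_hull_integral_le P _ 1 1 mu bm1.
  by rewrite mul1r; apply => // p _; rewrite E1 mul1r.
have := @closed_convex_hull_integral_le P _ (-1) (-1) mu bm1.
by rewrite mulN1r lerN2; apply => // p _; rewrite E1 mulr1.
Qed.

End closed_convex_hull_theory.

(** * Risk of a test and the lower bound by total variation *)

Section risk_theory.
Context (R : realType) (d : measure_display) (T : measurableType d).
Implicit Types (P Q : set (probability T R)) (phi : T -> R).

Lemma test_integrable (p : probability T R) phi : tests phi ->
  p.-integrable setT (EFin \o phi).
Proof. by move/tests_bounded_measurable/bounded_measurable_integrable. Qed.

Lemma Rintegral_cst1 (p : probability T R) : \int[p]_x (cst 1 x) = 1.
Proof. by rewrite Rintegral_cst//= probability_setT mulr1. Qed.

Lemma test_expectation_le1 (p : probability T R) phi : tests phi ->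
  fine 'E_p[phi] <= 1.
Proof.
move=> tphi; rewrite fine_expectation -(Rintegral_cst1 p).
apply: le_Rintegral => //; first exact: test_integrable.
  exact: test_integrable (@tests_cst1 R d T).
by move=> x _; have /andP[] := tphi.2 x.
Qed.

Lemma tests_onem phi : tests phi -> tests (fun x => 1 - phi x).
Proof.
move=> [mphi phi01]; split => [|x]; first exact: measurable_funB.
by have /andP[? ?] := phi01 x; apply/andP; split; lra.
Qed.

Lemma test_expectation_onem (p : probability T R) phi : tests phi ->
  fine 'E_p[fun x => 1 - phi x] = 1 - fine 'E_p[phi].
Proof.
move=> tphi; rewrite !fine_expectation -[in RHS](Rintegral_cst1 p) RintegralB//.
- exact: test_integrable (@tests_cst1 R d T).
- exact: test_integrable.
Qed.

(** The bound 1 on expectations of tests makes this a genuine supremum rather than the default value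
    of [sup]. *)
Lemma le_sup_test_expectation P phi p : tests phi -> P p ->
  fine 'E_p[phi] <= sup [set fine 'E_mu[phi] | mu in P].
Proof.
move=> tphi Pp; apply: ub_le_sup; last by exists p.
by exists 1 => _ [q _ <-]; exact: test_expectation_le1.
Qed.

Lemma risk_ge P Q phi (mu nu : ba R T) : tests phi ->
  closed_convex_hull P mu -> closed_convex_hull Q nu ->
  1 - dTV mu nu <= risk phi P Q.
Proof.
move=> tphi Pmu Qnu; have bmphi := tests_bounded_measurable tphi.
have munu : mu setT = nu setT.
  by rewrite (closed_convex_hull_setT Pmu) (closed_convex_hull_setT Qnu).
set s := sup [set fine 'E_p[phi] | p in P].
set t := sup [set fine 'E_q[fun x => 1 - phi x] | q in Q].
have mus : 1 * ba_integral mu phi <= s.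
  apply: (closed_convex_hull_integral_le bmphi _ Pmu) => p Pp.
  by rewrite mul1r; exact: le_sup_test_expectation.
(* The constant comes from [1 - E_q[phi] <= t] for each [q] in [Q], rearranged with sign -1. *)
have nut : -1 * ba_integral nu phi <= t - 1.
  apply: (closed_convex_hull_integral_le bmphi _ Qnu) => q Qq.
  have := le_sup_test_expectation (tests_onem tphi) Qq.
  by rewrite -/t test_expectation_onem//; lra.
have := ba_integral_test_dTV munu tphi; rewrite ler_norml => /andP[? _].
by rewrite /risk -/s -/t; lra.
Qed.

End risk_theory.

Theorem corollary1p10 (R : realType) (d : measure_display)
    (T : measurableType d) (P Q : set (probability T R))
    (P0 : P !=set0) (Q0 : Q !=set0) :
  (forall (phi : T -> R) (mu nu : ba R T),
     tests phi -> closed_convex_hull P mu -> closed_convex_hull Q nu ->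
     risk phi P Q >= 1 - dTV mu nu) /\
  (forall (phi : T -> R) (mu nu : ba R T),
     tests phi -> closed_convex_hull P mu -> closed_convex_hull Q nu ->
     risk phi P Q = 1 - dTV mu nu ->
     risk phi P Q = minimax_risk P Q /\
     dTV mu nu = dTV_set (closed_convex_hull P) (closed_convex_hull Q)).
Proof.
split => [phi mu nu|phi mu nu tphi Pmu Qnu E]; first exact: risk_ge.
split; apply/eqP; rewrite eq_le; apply/andP; split.
(* The pair [(mu, nu)] bounds the risk of every competing test from below by [1 - dTV mu nu], which
   [phi] attains. *)
- apply: lb_le_inf; first by exists (risk phi P Q); exists phi.
  by move=> _ [psi tpsi <-]; rewrite E; exact: risk_ge.
- apply: ge_inf; last by exists phi.
  by exists (1 - dTV mu nu) => _ [psi tpsi <-]; exact: risk_ge.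
(* Dually, [phi] is kept fixed and the bound is applied to every competing pair. *)
- apply: lb_le_inf; first by exists (dTV mu nu); exists mu => //; exists nu.
  move=> _ [mu' Pmu' [nu' Qnu' <-]].
  by have := risk_ge tphi Pmu' Qnu'; rewrite E lerD2l lerN2.
- apply: ge_inf; last by exists mu => //; exists nu.
  (* The same inequality, solved for the distance, gives the lower bound that [inf] requires. *)
  exists (1 - risk phi P Q) => _ [mu' Pmu' [nu' Qnu' <-]].
  by have := risk_ge tphi Pmu' Qnu'; lra.
Qed.
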